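(* If $A\subseteq\mathcal{C}^{2,3}$ is admissible, then all compatible orders for $A$ are equivalent, i.e. any two compatible orders for $A$ can be obtained from one another by a finite sequence of elementary operations.
   Context: $S_n$ is the group of permutations of $[n]=\{1,\dots,n\}$, $n\ge1$, with the Bruhat order $\le$: $\tau\le\sigma$ iff $\#(\tau([i])\cap[j])\ge\#(\sigma([i])\cap[j])$ for all $i,j\in[n]$. $\mathcal{T}=\{T_{i,j}:1\le i<j\le n\}$ is the set of transpositions; for $i<j<k$, $R_{i,j,k}$ is the $3$-cycle $i\mapsto j\mapsto k\mapsto i$ and $L_{i,j,k}=R_{i,j,k}^{-1}$; $\mathcal{C}^{2,3}=\mathcal{T}\cup\{R_{i,j,k},L_{i,j,k}:i<j<k\}$. A subset $A\subseteq\mathcal{C}^{2,3}$ is admissible if (a) it is downward closed: $\sigma\in A$, $\tau\in\mathcal{C}^{2,3}$, $\tau\le\sigma$ imply $\tau\in A$; (b) if $R_{i,j,l},L_{i,k,l}\in A$ with $i<j<l$, $i<k<l$, then $T_{i,l}\in A$; (c) if $T_{i,j},T_{j,k}\in A$ with $i<j<k$, then at least one of $R_{i,j,k},L_{i,j,k}$ is in $A$. Put $A_{\mathcal{T}}=A\cap\mathcal{T}$. A compatible order for an admissible $A$ is a strict total order $\prec$ on $A_{\mathcal{T}}$ such that for all $i<j<k$: if $R_{i,j,k}\in A$ but $L_{i,j,k}\notin A$, then $T_{i,j}\prec T_{j,k}$; if $L_{i,j,k}\in A$ but $R_{i,j,k}\notin A$, then $T_{j,k}\prec T_{i,j}$;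 if $T_{i,k}\in A$, then either $T_{i,j}\prec T_{i,k}\prec T_{j,k}$ or $T_{j,k}\prec T_{i,k}\prec T_{i,j}$. The elementary operations on compatible orders are: (1) if $T_{i,j}$ and $T_{k,l}$ are consecutive in $\prec$ and $\{i,j\}\cap\{k,l\}=\emptyset$, switch the order of these two elements (and of no others); (2) if $T_{i,j},T_{i,k},T_{j,k}$ with $i<j<k$ are consecutive in $\prec$, in this order or in the reverse order, reverse the order of these three elements (and otherwise keep $\prec$). These operations yield compatible orders. *)

(* Defs.v *)
From Stdlib Require Import Relations.
From mathcomp Require Import all_boot all_fingroup.

Set Implicit Arguments.
Unset Strict Implicit.
Unset Printing Implicit Defensive.

(* 'I_n = {0, ..., n-1} stands for [n] = {1, ..., n}, and T_{i,j} is
   [tperm i j].  The initial segment [i] of the paper becomes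
   [set x | x <= i], with i : 'I_n the (i+1)-st index. *)
Definition initial (n : nat) (i : 'I_n) : {set 'I_n} :=
  [set x : 'I_n | x <= i].

Definition bruhat (n : nat) (t s : 'S_n) : Prop :=
  forall i j : 'I_n,
    #|s @: initial i :&: initial j| <= #|t @: initial i :&: initial j|.

Definition transpositions (n : nat) : {set 'S_n} :=
  [set s : 'S_n | [exists i : 'I_n, exists j : 'I_n,
                     (i < j) && (s == tperm i j)]].

(* The product of permutations is composition from left to right:
   (s * t)%g x = t (s x). *)
Definition rcycle (n : nat) (i j k : 'I_n) : 'S_n :=
  (tperm i j * tperm i k)%g.

Definition lcycle (n : nat) (i j k : 'I_n) : 'S_n := ((rcycle i j k)^-1)%g.

Fact rcycleE (n : nat) (i j k : 'I_n) : i < j -> j < k ->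
  [/\ rcycle i j k i = j, rcycle i j k j = k & rcycle i j k k = i].
Proof.
move=> ij jk; have ik := ltn_trans ij jk.
have nij : i != j by rewrite neq_ltn ij.
have njk : j != k by rewrite neq_ltn jk.
have nik : i != k by rewrite neq_ltn ik.
split; rewrite /rcycle permM.
- by rewrite tpermL (tpermD nij) 1?eq_sym.
- by rewrite tpermR tpermL.
- by rewrite (tpermD nik njk) tpermR.
Qed.

Definition cycles23 (n : nat) : {set 'S_n} :=
  transpositions n :|:
  [set s : 'S_n | [exists i : 'I_n, exists j : 'I_n, exists k : 'I_n,
      [&& i < j, j < k & (s == rcycle i j k) || (s == lcycle i j k)]]].

Record admissible (n : nat) (A : {set 'S_n}) : Prop := Admissible {
  admissible_sub : A \subset cycles23 n;
  admissible_down : forall s t : 'S_n,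
    s \in A -> t \in cycles23 n -> bruhat t s -> t \in A;
  admissible_RL : forall i j k l : 'I_n, i < j -> j < l -> i < k -> k < l ->
    rcycle i j l \in A -> lcycle i k l \in A -> tperm i l \in A;
  admissible_TT : forall i j k : 'I_n, i < j -> j < k ->
    tperm i j \in A -> tperm j k \in A ->
    rcycle i j k \in A \/ lcycle i j k \in A
}.

(* A binary relation on a subset of T is its graph, a set of pairs, so that
   equality of relations is Leibniz equality. *)
Record strict_total_order (T : finType) (B : {set T}) (P : {set T * T}) :
    Prop := StrictTotalOrder {
  sto_sub : P \subset setX B B;
  sto_irr : forall x, (x, x) \notin P;
  sto_trans : forall x y z, (x, y) \in P -> (y, z) \in P -> (x, z) \in P;
  sto_total : forall x y, x \in B -> y \in B -> x != y ->
    (x, y) \in P \/ (y, x) \in P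
}.

Record compatible (n : nat) (A : {set 'S_n}) (P : {set 'S_n * 'S_n}) :
    Prop := Compatible {
  compatible_order : strict_total_order (A :&: transpositions n) P;
  compatible_R : forall i j k : 'I_n, i < j -> j < k ->
    rcycle i j k \in A -> lcycle i j k \notin A ->
    (tperm i j, tperm j k) \in P;
  compatible_L : forall i j k : 'I_n, i < j -> j < k ->
    lcycle i j k \in A -> rcycle i j k \notin A ->
    (tperm j k, tperm i j) \in P;
  compatible_T : forall i j k : 'I_n, i < j -> j < k -> tperm i k \in A ->
    ((tperm i j, tperm i k) \in P /\ (tperm i k, tperm j k) \in P) \/
    ((tperm j k, tperm i k) \in P /\ (tperm i k, tperm i j) \in P)
}.

Definition consecutive (T : finType) (P : {set T * T}) (x y : T) : Prop :=
  (x, y) \in P /\ forall z, ~ ((x, z) \in P /\ (z, y) \in P).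

Definition reverse_on (T : finType) (B : {set T}) (P : {set T * T}) :
    {set T * T} :=
  [set p | if (p.1 \in B) && (p.2 \in B) then (p.2, p.1) \in P else p \in P].

(* [elementary A P Q]: Q results from an elementary operation applied to the
   compatible order P.  In [elementary_swap] only T_{i,j} < T_{k,l} is spelt
   out, as the roles of the two transpositions may be exchanged. *)
Inductive elementary (n : nat) (A : {set 'S_n}) (P : {set 'S_n * 'S_n}) :
    {set 'S_n * 'S_n} -> Prop :=
| elementary_swap (i j k l : 'I_n) :
    compatible A P -> i < j -> k < l ->
    [disjoint [set i; j] & [set k; l]] ->
    consecutive P (tperm i j) (tperm k l) ->
    elementary A P (reverse_on [set tperm i j; tperm k l] P)
| elementary_reverse (i j k : 'I_n) :
    compatible A P -> i < j -> j < k ->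
    (consecutive P (tperm i j) (tperm i k) /\
     consecutive P (tperm i k) (tperm j k)) \/
    (consecutive P (tperm j k) (tperm i k) /\
     consecutive P (tperm i k) (tperm i j)) ->
    elementary A P (reverse_on [set tperm i j; tperm i k; tperm j k] P).

Definition equivalent_orders (n : nat) (A : {set 'S_n}) :
    relation {set 'S_n * 'S_n} :=
  clos_refl_trans _ (@elementary n A).

(* Main.v *)
Require Import Defs.
From mathcomp Require Import all_boot all_fingroup.
From Stdlib Require Import Relations.
From mathcomp Require Import zify.

(* Write a compatible order as the list of its edges (i,j), i < j.  Condition
   (b) and downward closure make the prescribed order of a path i < j < k with
   (i,k) not an edge depend on its top vertex k alone.  Up to reversing all
   lists, let the top vertex k ask for (i,j) before (j,k).  Then every edge
   (a,b) with b < k can be moved in front of all the edges (d,k) preceding it: it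
   commutes with them, except possibly for two consecutive ones (b,k), (a,k),
   across which it passes by reversing the triangle a < b < k.  In the
   resulting list the edges ending in k come last, in increasing order, and the
   remaining ones form a compatible order on the smaller vertices; conclude by
   induction. *)

Set Implicit Arguments.
Unset Strict Implicit.
Unset Printing Implicit Defensive.

(** * Positions in lists and reversal of a block *)

Definition before (T : eqType) (s : seq T) (x y : T) : bool :=
  index x s < index y s.

Lemma index_rev (T : eqType) (s : seq T) x :
  uniq s -> x \in s -> index x (rev s) = size s - (index x s).+1.
Proof.
move=> us xs; have ix : index x s < size s by rewrite index_mem.
rewrite -{1}(nth_index x xs).
have -> : nth x s (index x s) = nth x (rev s) (size s - (index x s).+1).
  by rewrite nth_rev; [congr nth; lia | lia].
by rewrite index_uniq ?rev_uniq ?size_rev //; lia.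
Qed.

(** Reversal leaves the block on the same interval of positions, so only the pairs inside [b] change
    their order, exactly as in [reverse_on]. *)
Lemma before_rev_cat (T : eqType) (l b r : seq T) x y :
  uniq (l ++ b ++ r) ->
  before (l ++ rev b ++ r) x y =
    if (x \in b) && (y \in b) then before (l ++ b ++ r) y x
    else before (l ++ b ++ r) x y.
Proof.
move=> u; have ub : uniq b by move: u; rewrite !cat_uniq => /and5P[].
have lb z : z \in b -> (z \in l) = false.
  move=> zb; apply/negP => zl; move: u; rewrite cat_uniq.
  by case/and3P=> _ /hasPn/(_ z) + _; rewrite mem_cat zb zl => /(_ isT).
rewrite /before !index_cat !mem_rev size_rev.
have ltb z : z \in b -> index z b < size b by rewrite index_mem.
have ltl z : z \in l -> index z l < size l by rewrite index_mem.
have [xb|xb] := boolP (x \in b); have [yb|yb] := boolP (y \in b) => //=.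
- by rewrite !lb // !index_rev //; have := ltb _ xb; have := ltb _ yb; lia.
- rewrite lb // index_rev //; case: ifP => [/ltl|_]; have := ltb _ xb; lia.
- rewrite (lb y) // index_rev //; case: ifP => [/ltl|_]; have := ltb _ yb; lia.
Qed.

Lemma before_rev (T : eqType) (s : seq T) x y :
  uniq s -> x \in s -> y \in s -> before (rev s) x y = before s y x.
Proof.
move=> us xs ys; have := @before_rev_cat T [::] s [::] x y.
by rewrite /= !cats0 xs ys; apply.
Qed.

Lemma before_cat (T : eqType) (s t : seq T) x y :
  uniq (s ++ t) -> x \in s -> y \in t -> before (s ++ t) x y.
Proof.
rewrite cat_uniq => /and3P[_ /hasPn st _] xs yt.
rewrite /before !index_cat xs (negbTE (st _ yt)).
by rewrite (leq_trans _ (leq_addr _ _)) // index_mem.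
Qed.

Lemma before_trans (T : eqType) (s : seq T) y x z :
  before s x y -> before s y z -> before s x z.
Proof. exact: ltn_trans. Qed.

Lemma before_asym (T : eqType) (s : seq T) x y :
  before s x y -> ~~ before s y x.
Proof. by rewrite -leqNgt => /ltnW. Qed.

(** * Lists of edges up to block reversals *)

Section EdgeOrders.
Variable n : nat.
Notation edge := ('I_n * 'I_n)%type.
Implicit Types (i j k : 'I_n) (x y z : edge) (s t b u v c : seq edge).

Definition commuting x y : bool :=
  [&& x.1 != y.1, x.1 != y.2, x.2 != y.1 & x.2 != y.2].

Lemma commutingC x y : commuting x y = commuting y x.
Proof.
rewrite /commuting ![y.1 == _]eq_sym ![y.2 == _]eq_sym.
by congr (_ && _); rewrite andbCA.
Qed.

(** These are the lists that an elementary operation reverses. A triangle occurs in both directions,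
    which makes moves reversible. *)
Inductive block : seq edge -> Prop :=
| block_pair x y of x.1 < x.2 & y.1 < y.2 & commuting x y : block [:: x; y]
| block_triangle i j k of i < j & j < k : block [:: (i, j); (i, k); (j, k)]
| block_triangle_rev i j k of i < j & j < k :
    block [:: (j, k); (i, k); (i, j)].

Lemma block_rev b : block b -> block (rev b).
Proof.
by case=> [x y xx yy xy|i j k ij jk|i j k ij jk]; constructor=> //;
  rewrite commutingC.
Qed.

Inductive move : seq edge -> seq edge -> Prop :=
| Move l b r of block b : move (l ++ b ++ r) (l ++ rev b ++ r).

Arguments Move l [b] r _.

Definition moves := clos_refl_trans _ move.

Lemma moves_refl s : moves s s. Proof. exact: rt_refl. Qed.

Lemma moves_trans t s v : moves s t -> moves t v -> moves s v.
Proof. exact: rt_trans. Qed.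

Lemma move_sym s t : move s t -> move t s.
Proof.
by case=> l b r /block_rev/(Move l r); rewrite revK.
Qed.

Lemma moves_sym s t : moves s t -> moves t s.
Proof.
elim=> [a d /move_sym|a|a d e _ + _]; [exact: rt_step|exact: rt_refl|].
by move=> da ed; exact: moves_trans ed da.
Qed.

Lemma moves_morph (f : seq edge -> seq edge) :
  (forall s t, move s t -> move (f s) (f t)) ->
  forall s t, moves s t -> moves (f s) (f t).
Proof.
move=> fM s t; elim=> [a d /fM|a|a d e _ ad _ de];
  [exact: rt_step|exact: rt_refl|].
exact: moves_trans ad de.
Qed.

Lemma moves_cat l r s t : moves s t -> moves (l ++ s ++ r) (l ++ t ++ r).
Proof.
apply: (moves_morph (f := fun s => l ++ s ++ r)) => {s t} _ _ [l' b r' bb].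
by have := Move (l ++ l') (r' ++ r) bb; rewrite -!catA.
Qed.

Lemma moves_rev s t : moves s t -> moves (rev s) (rev t).
Proof.
apply: moves_morph => {s t} _ _ [l b r bb].
by rewrite !rev_cat -!catA; apply: Move; apply: block_rev.
Qed.

Lemma moves_shift x c : x.1 < x.2 ->
  {in c, forall y, (y.1 < y.2) && commuting y x} ->
  moves (c ++ [:: x]) (x :: c).
Proof.
move=> xx; elim: c => [|y c IH] cx; first exact: moves_refl.
have /IH/(moves_cat [:: y] [::]) :
    {in c, forall z, (z.1 < z.2) && commuting z x}.
  by move=> z zc; apply: cx; rewrite inE zc orbT.
rewrite !cats0; move/moves_trans; apply.
have /andP[yy yx] := cx y (mem_head _ _).
by apply: rt_step; exact: (Move [::] c (block_pair yy xx yx)).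
Qed.

(* A nonedge {i,k} with a common neighbour between i and k prescribes the
   order of the two edges of that path; [o k] tells which order, and it
   depends on [k] only. *)
Variable E : rel 'I_n.
Hypothesis E_lt : forall i j, E i j -> i < j.
Hypothesis E_sub : forall i j k, i < j -> j < k -> E i k -> E i j && E j k.
Implicit Type o : pred 'I_n.

(** The list form of a compatible order, cut down to the edges whose upper vertex is below [m], so
    that an induction can remove the vertices from the top. *)
Record valid o (m : nat) s : Prop := Valid {
  valid_uniq : uniq s;
  valid_mem : forall x, (x \in s) = E x.1 x.2 && (x.2 < m);
  valid_triangle : forall i j k, i < j -> j < k -> k < m -> E i k ->
    before s (i, j) (i, k) && before s (i, k) (j, k) ||
    before s (j, k) (i, k) && before s (i, k) (i, j);
  valid_path : forall i j k, k < m -> E i j -> E j k -> ~~ E i k ->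
    if o k then before s (i, j) (j, k) else before s (j, k) (i, j) }.

Lemma valid_rev o m s : valid o m s -> valid (predC o) m (rev s).
Proof.
case=> us ms ts ps; split=> [|x|i j k ij jk km ik|i j k km ij jk ik].
- by rewrite rev_uniq.
- by rewrite mem_rev ms.
- have /andP[Eij Ejk] := E_sub ij jk ik; have jm := ltn_trans jk km.
  have := ts _ _ _ ij jk km ik.
  rewrite !before_rev ?ms ?Eij ?Ejk ?ik ?jm ?km //.
  by rewrite andbC orbC [X in X || _]andbC orbC.
- have jm := ltn_trans (E_lt jk) km.
  have := ps _ _ _ km ij jk ik.
  by rewrite !before_rev ?ms ?ij ?jk ?jm ?km //=; case: (o k).
Qed.

(** Commuting edges share no vertex, and two edges of a triangle determine the third, so a block
    holding two edges of a triangle holds all three. Hence a move keeps or reverses the order of a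
    triangle as a whole. *)
Lemma block_triangle_mem b i j k : block b -> i < j -> j < k ->
  ((i, j) \in b) && ((i, k) \in b) = ((i, j) \in b) && ((j, k) \in b) /\
  ((i, k) \in b) && ((j, k) \in b) = ((i, j) \in b) && ((j, k) \in b).
Proof.
case=> [[p q] [p' q'] /=|i' j' k'|i' j' k']; rewrite ?/commuting /= => lt1 lt2.
all: by rewrite !inE -!pair_eqE /= -!val_eqE /=; lia.
Qed.

Lemma move_perm s t : move s t -> perm_eq s t.
Proof. by case=> l b r _; rewrite perm_cat2l perm_cat2r perm_sym perm_rev. Qed.

Lemma move_valid o m s t : move s t -> valid o m s -> valid o m t.
Proof.
move=> mst [us ms ts ps]; have pst := move_perm mst; split=> [|x||].
- by rewrite -(perm_uniq pst).
- by rewrite -(perm_mem pst).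
- case: mst us ms ts ps {pst} => l b r bb us ms ts ps i j k ij jk km ik.
  rewrite !before_rev_cat //.
  rewrite ![((_, k) \in b) && ((i, _) \in b)]andbC.
  have [-> ->] := block_triangle_mem bb ij jk.
  have := ts _ _ _ ij jk km ik.
  by case: ifP => // _; rewrite orbC andbC [X in _ || X]andbC.
- case: mst us ms ts ps {pst} => l b r bb us ms ts ps i j k km ij jk ik.
  have [Z _] := block_triangle_mem bb (E_lt ij) (E_lt jk).
  (* The nonedge [(i,k)] is not listed, so no block contains both edges of the path, and their order
     is preserved. *)
  have ikb : ((i, k) \in b) = false.
    apply/negP => ikb; have := ms (i, k).
    by rewrite !mem_cat ikb orbT /= (negbTE ik).
  rewrite ikb andbF in Z;
    rewrite !before_rev_cat // [(_ \in b) && ((i, j) \in b)]andbC.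
  by rewrite -Z; apply: ps.
Qed.

Lemma moves_valid o m s t : moves s t -> valid o m s -> valid o m t.
Proof.
elim=> // [a d|a d e _ ad _ de /ad/de //]; exact: move_valid.
Qed.


(** * Moving the edges with top vertex [k] to the end *)

Lemma valid_edge o m s x : valid o m s -> x \in s -> E x.1 x.2.
Proof. by case=> _ -> _ _ /andP[]. Qed.

(* If (a,b) comes after (b,k), then orientation [o k] forces (b,k), (a,k), (a,b)
   in this order; no (d,k) lies between (b,k) and (a,k), for the triangles
   dbk, dak and dab would give (a,b) a predecessor outside of [u] and [c]. *)
Lemma push_edge o k u c (a b : 'I_n) v : o k ->
  valid o k.+1 (u ++ c ++ (a, b) :: v) ->
  {in u, forall x, x.2 < k} -> {in c, forall x, x.2 = k} -> b < k ->
  exists2 c', perm_eq c c' & moves (c ++ [:: (a, b)]) ((a, b) :: c').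
Proof.
set s := u ++ _ => ok vs uk ck bk.
have us : uniq s := valid_uniq vs.
have abE : E a b.
  by apply: (valid_edge (x := (a, b)) vs); rewrite !mem_cat mem_head !orbT.
have ab := E_lt abE; have ak := ltn_trans ab bk.
have cE (d : 'I_n) : (d, k) \in c -> E d k.
  by move=> dc; apply: (valid_edge (x := (d, k)) vs); rewrite !mem_cat dc orbT.
have cab z : z \in c -> before s z (a, b).
  move=> zc; have := us; rewrite /s catA => us'; apply: before_cat us' _ _.
    by rewrite mem_cat zc orbT.
  exact: mem_head.
(* Between a member of [c] and [(a,b)] there are only edges ending in [k], so an edge with a smaller
   top that follows this member cannot precede [(a,b)]. *)
have later i j z : z \in c -> j < k -> E i j -> before s z (i, j) ->
    ((i, j) == (a, b)) || before s (a, b) (i, j).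
  move=> zc jk ij zy; have : (i, j) \in s by rewrite (valid_mem vs) ij /= leqW.
  rewrite /s !mem_cat inE => /or4P[yu|yc|->//|yv].
  - have /before_asym : before s (i, j) z by apply: before_cat us yu _;
    rewrite mem_cat zc.
    by move: zy; rewrite /before; lia.
  - by have /= jek := ck _ yc; move: jk; rewrite jek ltnn.
  - apply/orP; right; have := us; rewrite /s -cat_rcons catA => us'.
    by apply: before_cat us' _ yv; rewrite mem_cat mem_rcons mem_head orbT.
have tri (i j l : 'I_n) : i < j -> j < l -> l <= k -> E i l ->
    before s (i, j) (i, l) && before s (i, l) (j, l) ||
    before s (j, l) (i, l) && before s (i, l) (i, j).
  by move=> ij jl lk il; apply: (valid_triangle vs) => //; rewrite ltnS.
have comm z : z \in c -> z != (a, k) -> z != (b, k) ->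
    (z.1 < z.2) && commuting z (a, b).
  case: z => d k' zc; have /= kk := ck _ zc; subst k'.
  have := E_lt (cE _ zc); rewrite /commuting -!pair_eqE /= -!val_eqE /=; lia.
(* No edge of [u] ends in [k], so the edges ending in [k] that precede [(a,b)] are all in [c]. *)
have early (d : 'I_n) : E d k -> before s (d, k) (a, b) -> (d, k) \in c.
  move=> dk dab; have : (d, k) \in s by rewrite (valid_mem vs) dk /=.
  rewrite /s catA mem_cat [X in X || _]mem_cat inE => /orP[/orP[]//|].
    by move/uk; rewrite ltnn.
  case/orP=> [/eqP[_] kb|dv]; first by move: bk; rewrite kb ltnn.
  suff /before_asym : before s (a, b) (d, k) by rewrite dab.
  have := us; rewrite /s -cat_rcons catA => us'.
  by apply: before_cat us' _ dv; rewrite mem_cat mem_rcons mem_head orbT.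
(* Here [o k] enters: if [(a,k)] were a nonedge, [(a,b)] would have to precede [(b,k)]. So [(a,k)]
   is an edge, and its triangle runs from [(b,k)] to [(a,b)]. *)
have bk_c : (b, k) \in c -> (a, k) \in c /\ before s (b, k) (a, k).
  move=> bc; have := cab _ bc; have [akE|akE] := boolP (E a k).
    case/orP: (tri _ _ _ ab bk (leqnn _) akE) => /andP[B1 B2] B3.
      by have := before_asym (before_trans B1 B2); rewrite B3.
    by split=> //; apply: early => //; apply: before_trans B2 _.
  have := valid_path vs (ltnSn k) abE (cE _ bc) akE.
  by rewrite ok => /before_asym; rewrite (cab _ bc).
(* Without [(a,k)], the edge [(b,k)] is missing from [c] too, and [(a,b)] commutes with all of
   [c]. *)
have [akc|akc] := boolP ((a, k) \in c); last first.
  exists c => //; apply: moves_shift => // z zc; apply: comm => //.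
    by apply: contraNneq akc => <-.
  by apply: contraNneq akc => zb; rewrite zb in zc; case: (bk_c zc).
have akE := cE _ akc.
(* As [(a,k)] precedes [(a,b)], the triangle [a < b < k] puts [(b,k)] even earlier. *)
have bkc : (b, k) \in c.
  have /andP[_ bkE] := E_sub ab bk akE; have := cab _ akc.
  case/orP: (tri _ _ _ ab bk (leqnn _) akE) => /andP[B1 B2] B3.
    by have := before_asym B1; rewrite B3.
  exact: early bkE (before_trans B1 B3).
have [_ bka] := bk_c bkc; have bkE := cE _ bkc.
have between (d : 'I_n) : (d, k) \in c ->
    ~~ (before s (b, k) (d, k) && before s (d, k) (a, k)).
  move=> dc; apply/negP => /andP[B1 B2].
  have dkE := cE _ dc; have dk := E_lt dkE.
  have aab := cab _ akc.
  have [] : d != a /\ d != b.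
    by split; apply/eqP => dd; move: B1 B2; rewrite dd /before ltnn.
  rewrite -!val_eqE /= => da db.
  (* If [d < a], the triangles force the cycle [(a,b)], [(d,b)], [(d,a)], [(d,k)], [(a,k)], [(a,b)]
     of successive edges. *)
  have [dla|dga] := ltnP d a.
    have /andP[daE _] := E_sub dla ak dkE.
    have dlb := ltn_trans dla ab.
    have /andP[dbE _] := E_sub dlb bk dkE.
    have /andP[daB _] : before s (d, a) (d, k) && before s (d, k) (a, k).
      have := tri _ _ _ dla ak (leqnn _) dkE.
      by rewrite (negbTE (before_asym B2)) orbF.
    have /andP[_ dbB] : before s (b, k) (d, k) && before s (d, k) (d, b).
      have := tri _ _ _ dlb bk (leqnn _) dkE.
      by rewrite (negbTE (before_asym B1)) andbF.
    have := later _ _ _ dc bk dbE dbB.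
    rewrite -pair_eqE /= -!val_eqE /= (negbTE da) /= => abdb.
    have := tri _ _ _ dla ab (ltnW bk) dbE.
    rewrite (negbTE (before_asym abdb)) andbF /= => /andP[_ dbda].
    have := before_trans (before_trans (before_trans abdb dbda) daB)
      (before_trans B2 aab).
    by rewrite /before ltnn.
  have {dga} da' : a < d by rewrite ltn_neqAle eq_sym da.
  have /andP[adE _] := E_sub da' dk akE.
  have /andP[_ adB] : before s (d, k) (a, k) && before s (a, k) (a, d).
    have := tri _ _ _ da' dk (leqnn _) akE.
    by rewrite (negbTE (before_asym B2)) andbF.
  have := later _ _ _ akc dk adE adB.
  rewrite -pair_eqE /= -!val_eqE /= (negbTE db) andbF /= => abad.
  (* If [a < d < b], both [(a,d)] and [(d,b)] follow [(a,b)], whereas their triangle puts [(a,b)]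
     between them. *)
  have [dlb|dgb] := ltnP d b.
    have /andP[_ dbE] := E_sub da' dlb abE.
    have /andP[_ dbB] : before s (b, k) (d, k) && before s (d, k) (d, b).
      have := tri _ _ _ dlb bk (leqnn _) dkE.
      by rewrite (negbTE (before_asym B1)) andbF.
    have := later _ _ _ dc bk dbE dbB.
    rewrite -pair_eqE /= -!val_eqE /= (negbTE da) /= => abdb.
    have := tri _ _ _ da' dlb (ltnW bk) abE.
    by rewrite (negbTE (before_asym abad)) (negbTE (before_asym abdb)).
  (* If [b < d], the cycle is [(a,b)], [(a,d)], [(b,d)], [(b,k)], [(a,k)], [(a,b)]. *)
  have {dgb} bd : b < d by rewrite ltn_neqAle eq_sym db.
  have /andP[bdB _] : before s (b, d) (b, k) && before s (b, k) (d, k).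
    have := tri _ _ _ bd dk (leqnn _) bkE.
    by rewrite (negbTE (before_asym B1)) orbF.
  have := tri _ _ _ ab bd (ltnW dk) adE.
  rewrite (negbTE (before_asym abad)) andbF orbF => /andP[_ adbd].
  have := before_trans (before_trans abad adbd)
    (before_trans bdB (before_trans bka aab)).
  by rewrite /before ltnn.
have [p [r Ec]] : exists p r, c = p ++ (a, k) :: r.
  by case/splitPr: akc => p r; exists p, r.
have us1 : uniq ((u ++ p) ++ (a, k) :: r ++ (a, b) :: v).
  by move: us; rewrite /s Ec -!catA.
have bkp : (b, k) \in p.
  move: bkc; rewrite Ec mem_cat inE -pair_eqE /= => /or3P[//|/andP[/eqP ba]|br].
    by move: ab; rewrite ba ltnn.
  have us2 : uniq ((u ++ p ++ [:: (a, k)]) ++ (r ++ (a, b) :: v)).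
    by move: us; rewrite /s Ec -!catA.
  have /before_asym : before s (a, k) (b, k).
    have := before_cat (x := (a, k)) (y := (b, k)) us2.
    by rewrite /s Ec -!catA; apply; rewrite !mem_cat ?mem_head ?br ?orbT.
  by rewrite bka.
have [c1 [c2 Ep]] : exists c1 c2, p = c1 ++ (b, k) :: c2.
  by case/splitPr: bkp => c1 c2; exists c1, c2.
have c2nil : c2 = [::].
  case: c2 Ep => // z c2 Ep; exfalso.
  have zc : z \in c by rewrite Ec Ep !(mem_cat, inE) eqxx !orbT.
  case: z zc Ep => d k' zc Ep; have /= kk := ck _ zc; subst k'.
  have /negP := between d zc; apply; apply/andP; split.
    have := @before_cat _ (u ++ c1 ++ [:: (b, k)])
      ((d, k) :: c2 ++ (a, k) :: r ++ (a, b) :: v) (b, k) (d, k).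
    rewrite /s Ec Ep -!catA /=; apply.
    + by move: us; rewrite /s Ec Ep -!catA.
    + by rewrite !mem_cat mem_head !orbT.
    + exact: mem_head.
  have := before_cat (x := (d, k)) (y := (a, k)) us1.
  rewrite /s Ec -!catA /=; apply.
  + by rewrite Ep !(mem_cat, inE) eqxx !orbT.
  + exact: mem_head.
rewrite {}c2nil in Ep.
have Ecc : c = c1 ++ [:: (b, k); (a, k)] ++ r by rewrite Ec Ep -catA.
have uc : uniq c by move: us; rewrite /s !cat_uniq => /and5P[].
have /and3P[bk_c1r ak_c1r _] :
    [&& (b, k) \notin c1 ++ r, (a, k) \notin c1 ++ r & uniq (c1 ++ r)].
  move: uc; rewrite Ecc uniq_catCA /= [(b, k) \in _]inE negb_or.
  by case/and3P=> /andP[_ ->] -> ->.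
have comm' z : z \in c1 ++ r -> (z.1 < z.2) && commuting z (a, b).
  move=> zc; apply: comm.
  - by move: zc; rewrite Ecc !mem_cat => /orP[] ->; rewrite ?orbT.
  - by apply: contraTneq zc => ->.
  - by apply: contraTneq zc => ->.
(* The edge [(a,b)] commutes past [r], the triangle block [(b,k)], [(a,k)], [(a,b)] is reversed,
   which exchanges the first two, and then [(a,b)] commutes past [c1]. *)
exists (c1 ++ [:: (a, k); (b, k)] ++ r).
  by rewrite Ecc perm_cat2l perm_cat2r (perm_catC [:: (b, k)] [:: (a, k)]).
rewrite Ecc -!catA.
have M1 := moves_shift (x := (a, b)) (c := r) ab.
have M2 := Move c1 r (block_triangle_rev ab bk).
have M3 := moves_shift (x := (a, b)) (c := c1) ab.
apply: (moves_trans (t := c1 ++ [:: (b, k); (a, k); (a, b)] ++ r)).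
  have := moves_cat (c1 ++ [:: (b, k); (a, k)]) [::] (M1 _).
  rewrite !cats0 -!catA; apply=> z zr; apply: comm'.
  by rewrite mem_cat zr orbT.
apply: (moves_trans (rt_step _ _ _ _ M2)).
have := moves_cat [::] ([:: (a, k); (b, k)] ++ r) (M3 _).
rewrite /= -!catA; apply=> z zr; apply: comm'.
by rewrite mem_cat zr.
Qed.

(** The list [v] is scanned from the left: an edge ending in [k] is appended to [c], any other one
    is pushed in front of [c] and appended to [u]. *)
Lemma gather_top o k u c v : o k -> valid o k.+1 (u ++ c ++ v) ->
  {in u, forall x, x.2 < k} -> {in c, forall x, x.2 = k} ->
  exists u' c', [/\ {in u', forall x, x.2 < k}, {in c', forall x, x.2 = k} &
                    moves (u ++ c ++ v) (u' ++ c')].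
Proof.
move=> ok; elim: v u c => [|[a b] v IH] u c vs uk ck.
  by exists u, c; rewrite cats0; split=> //; exact: moves_refl.
have bk : b <= k.
  have : (a, b) \in u ++ c ++ (a, b) :: v by rewrite !mem_cat mem_head !orbT.
  by rewrite (valid_mem vs) ltnS => /andP[].
move: bk; rewrite leq_eqVlt => /orP[/eqP/val_inj bk|bk].
  subst b; rewrite -cat_rcons in vs *; apply: IH => // x.
  by rewrite mem_rcons inE => /orP[/eqP->|/ck].
have [c' pc mc] := push_edge ok vs uk ck bk.
have mv : moves (u ++ c ++ (a, b) :: v) (rcons u (a, b) ++ c' ++ v).
  by have := moves_cat u v mc; rewrite cat_rcons -catA.
have [||u' [c'' [uk' ck' mv']]] := IH _ _ (moves_valid mv vs).
- by move=> x; rewrite mem_rcons inE => /orP[/eqP->|/uk].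
- by move=> x; rewrite -(perm_mem pc) => /ck.
by exists u', c''; split=> //; apply: moves_trans mv mv'.
Qed.

(** * Gathered lists and the induction on the top vertex *)

Section Gathered.
Variables (o : pred 'I_n) (k : 'I_n) (u c : seq edge).
Hypothesis vuc : valid o k.+1 (u ++ c).
Hypothesis uk : {in u, forall x, x.2 < k}.
Hypothesis ck : {in c, forall x, x.2 = k}.

Lemma gathered_valid : valid o k u.
Proof.
have us := valid_uniq vuc.
have um x : (x \in u) = E x.1 x.2 && (x.2 < k).
  have := valid_mem vuc x; rewrite mem_cat ltnS leq_eqVlt.
  have [xu /esym/andP[-> _]|xu] /= := boolP (x \in u); first by rewrite uk.
  have [/ck-> _|xc] := boolP (x \in c); first by rewrite ltnn andbF.
  by case: (E _ _) => //=; case: (x.2 < k) => //; rewrite orbT.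
(* Only [x] has to lie in [u]: if [y] does not, its position is at least [size u] in both lists. *)
have ub x y : x \in u -> before u x y = before (u ++ c) x y.
  move=> xu; rewrite /before !index_cat xu; case: ifP => // /negbT yu.
  by rewrite -index_mem in xu; rewrite (memNindex yu) xu ltn_addr.
split=> [|//|i j l ij jl lk il|i j l lk ij jl il].
- by move: us; rewrite cat_uniq => /and3P[].
- have /andP[Eij Ejl] := E_sub ij jl il; have jk := ltn_trans jl lk.
  by rewrite !ub ?um ?Eij ?Ejl ?il ?jk //; apply: (valid_triangle vuc) => //;
    exact: ltnW.
- have jk := ltn_trans (E_lt jl) lk.
  by rewrite !ub ?um ?ij ?jl ?jk //; apply: (valid_path vuc) => //; exact: ltnW.
Qed.

(** For edges [(b,k)] and [(a,k)] with [b < a], the edge [(b,a)] lies in [u] and so comes first in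
    its triangle with [k], which puts [(b,k)] before [(a,k)]. *)
Lemma gathered_sorted : sorted (fun x y => x.1 < y.1) c.
Proof.
rewrite sorted_pairwise; last by move=> y x z; exact: ltn_trans.
pose x0 : edge := (k, k).
have us := valid_uniq vuc; have := us; rewrite cat_uniq =>
  /and3P[_ /hasPn cu uc].
apply/(pairwiseP x0) => i j ic jc ij; rewrite ltnNge; apply/negP.
have xc := mem_nth x0 ic; have yc := mem_nth x0 jc.
have bxy : before (u ++ c) (nth x0 c i) (nth x0 c j).
  by rewrite /before !index_cat (negbTE (cu _ xc)) (negbTE (cu _ yc))
    !index_uniq // ltn_add2l.
have xE : E (nth x0 c i).1 (nth x0 c i).2.
  by apply: valid_edge vuc _; rewrite mem_cat xc orbT.
have yE : E (nth x0 c j).1 (nth x0 c j).2.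
  by apply: valid_edge vuc _; rewrite mem_cat yc orbT.
have xk := ck xc; have yk := ck yc; move: bxy xE yE xk yk xc yc.
case: (nth x0 c i) (nth x0 c j) => [a k1] [b k2] /= bxy xE yE ? ?; subst k1 k2.
move=> xc yc; rewrite leq_eqVlt => /orP[/eqP/val_inj ba|ba].
  by move: bxy; rewrite ba /before ltnn.
have ak := E_lt xE; have /andP[baE _] := E_sub ba ak yE.
have bau : (b, a) \in u by rewrite (valid_mem gathered_valid) baE.
have /before_asym B : before (u ++ c) (b, a) (a, k) by exact: before_cat.
have := valid_triangle vuc ba ak (ltnSn k) yE.
rewrite (negbTE (before_asym bxy)) andbF /= => /andP[_ B'].
by have /before_asym := before_cat us bau yc; rewrite B'.
Qed.

Lemma gathered_mem x : (x \in c) = E x.1 x.2 && (x.2 == k).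
Proof.
have := valid_mem vuc x; rewrite mem_cat ltnS leq_eqVlt -val_eqE.
have [xu _|xu /= ->] := boolP (x \in u).
  have := valid_uniq vuc; rewrite cat_uniq => /and3P[_ /hasPn cu _].
  have := uk xu; rewrite ltn_neqAle => /andP[/negbTE-> _]; rewrite andbF.
  by apply/negP => /cu/negP.
have := valid_mem gathered_valid x; rewrite (negbTE xu).
by case: (E _ _) => //= <-; rewrite orbF.
Qed.

End Gathered.

Lemma valid_moves m o s t : m <= n -> valid o m s -> valid o m t -> moves s t.
Proof.
elim: m o s t => [|m IH] o s t mn vs vt.
  have nil w : valid o 0 w -> w = [::].
    by case: w => // x w vw; have := valid_mem vw x; rewrite mem_head andbF.
  by rewrite (nil _ vs) (nil _ vt); exact: moves_refl.
(* The vertex of value [m] is the largest one that an edge of either list can end in. *)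
pose k := Ordinal mn.
have key o' s' t' : o' k -> valid o' k.+1 s' -> valid o' k.+1 t' -> moves s' t'.
  move=> ok vs' vt'.
  have [||u [c [uk ck su]]] := gather_top (u := [::]) (c := [::]) ok vs' => //.
  have [||u' [c' [uk' ck' tu']]] :=
    gather_top (u := [::]) (c := [::]) ok vt' => //.
  have vuc := moves_valid su vs'; have vuc' := moves_valid tu' vt'.
  (* Both lists consist of the edges ending in [k] and are strictly sorted, hence equal. *)
  have cc : c' = c.
    apply: irr_sorted_eq (gathered_sorted vuc' uk' ck')
      (gathered_sorted vuc uk ck) _.
    - by move=> y x z; exact: ltn_trans.
    - by move=> x; exact: ltnn.
    - by move=> x; rewrite (gathered_mem vuc') // (gathered_mem vuc).
  have uu := IH _ _ _ (ltnW mn) (gathered_valid vuc uk ck)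
    (gathered_valid vuc' uk' ck').
  apply: moves_trans su _; apply: moves_trans (moves_sym tu'); rewrite cc.
  exact: (moves_cat [::] c uu).
have [ok|ok] := boolP (o k); first exact: (key o).
(* The reversed lists are valid for the opposite orientation, to which [key] applies. *)
rewrite -(revK s) -(revK t); apply: moves_rev.
by apply: (key (predC o)) => //; apply: valid_rev.
Qed.

End EdgeOrders.

(** * Bruhat comparisons of transpositions and 3-cycles *)

Section Bruhat.
Variable n : nat.
Implicit Types (i j k x y p q : 'I_n) (s t w : 'S_n).

Lemma card_image_initial s p q :
  #|s @: initial p :&: initial q| = \sum_(x : 'I_n | x <= p) (s x <= q).
Proof.
have -> : s @: initial p :&: initial q =
  s @: [set x : 'I_n | (x <= p) && (s x <= q)].
  apply/setP => y; apply/setIP/imsetP => [[/imsetP[x xp ->] yq]|[x + ->]].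
    by exists x => //; move: xp yq; rewrite !inE => -> ->.
  by rewrite !inE => /andP[xp ->]; split=> //; apply: imset_f; rewrite inE.
rewrite card_imset; last exact: perm_inj.
by rewrite -sum1dep_card big_mkcondr; apply: eq_bigr => x _; case: leq.
Qed.

Lemma bruhat_trans t s w : bruhat s t -> bruhat t w -> bruhat s w.
Proof. by move=> st tw p q; apply: leq_trans (tw p q) (st p q). Qed.

(** Exchanging the values at positions [x < y] creates an inversion. The counts change only for
    [x <= p < y], where the term at [x] tests the larger value [s y] instead of [s x]. *)
Lemma bruhat_tperm s x y : x < y -> s x < s y -> bruhat s (tperm x y * s)%g.
Proof.
move=> xy sxy p q; rewrite !card_image_initial.
under eq_bigr => z do rewrite permM.
have nxy : x != y by rewrite -val_eqE neq_ltn xy.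
have [yp|py] := leqP y p.
  have xp : x <= p by apply: leq_trans yp; exact: ltnW.
  rewrite [leqRHS](reindex_inj (@perm_inj _ (tperm x y))) /=.
  rewrite [leqRHS](eq_bigl (fun z : 'I_n => z <= p)) // => z.
  by case: tpermP => [->|->|//]; rewrite xp yp.
have [xp|px] := leqP x p; last first.
  apply: leq_sum => z zp; rewrite tpermD //; apply: contraTneq zp => <-;
  by rewrite -ltnNge.
rewrite (bigD1 x) //= [leqRHS](bigD1 x) //= tpermL; apply: leq_add.
  by have [sy|//] := leqP (s y) q; rewrite (leq_trans (ltnW sxy) sy).
apply: leq_sum => z /andP[zp zx]; rewrite tpermD // 1?eq_sym //.
by apply: contraTneq zp => ->; rewrite -ltnNge.
Qed.

Lemma lcycleE i j k : lcycle i j k = (tperm i k * tperm i j)%g.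
Proof. by rewrite /lcycle /rcycle invMg !tpermV. Qed.

Lemma lcycleP i j k : i < j -> j < k ->
  [/\ lcycle i j k i = k, lcycle i j k j = i & lcycle i j k k = j].
Proof.
move=> ij jk; have [ri rj rk] := rcycleE ij jk.
by split; apply: (@perm_inj _ (rcycle i j k));
  rewrite /lcycle permKV ?ri ?rj ?rk.
Qed.

Lemma ltn_neqs i j k : i < j -> j < k -> [/\ i <> j, j <> k & i <> k].
Proof.
move=> ij jk; split=> [e|e|e]; first by rewrite e ltnn in ij.
  by rewrite e ltnn in jk.
by rewrite e ltnNge ltnW in ij.
Qed.

Lemma rcycle_bruhat_tperm i j k : i < j -> j < k ->
  bruhat (rcycle i j k) (tperm i k).
Proof.
move=> ij jk; have [ri rj _] := rcycleE ij jk.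
have := @bruhat_tperm (rcycle i j k) i j ij.
by rewrite ri rj /rcycle mulgA tperm2 mul1g; apply.
Qed.

Lemma lcycle_bruhat_tperm i j k : i < j -> j < k ->
  bruhat (lcycle i j k) (tperm i k).
Proof.
move=> ij jk; have [_ lj lk] := lcycleP ij jk.
have := @bruhat_tperm (lcycle i j k) j k jk.
rewrite lj lk lcycleE.
have -> : (tperm j k * (tperm i k * tperm i j))%g = tperm i k.
  have [nij njk nik] := ltn_neqs ij jk.
  by apply/permP => z; rewrite !permM; repeat case: tpermP; congruence.
exact.
Qed.

(** At the positions [i, i', j, k] the values change from [i, j, k, i'] to [j, i, k, i'] and then to
    [j, i', k, i]; each exchange creates an inversion. *)
Lemma rcycle_bruhat i i' j k : i < i' -> i' < j -> j < k ->
  bruhat (rcycle i' j k) (rcycle i j k).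
Proof.
move=> ii ij jk; have [ri rj rk] := rcycleE ij jk.
have [nii nij ni] := ltn_neqs ii ij; have [_ njk nik] := ltn_neqs ij jk.
have [_ _ nk] := ltn_neqs ii (ltn_trans ij jk).
have fi : rcycle i' j k i = i by rewrite /rcycle permM !tpermD //; apply/eqP;
  congruence.
have B1 : bruhat (rcycle i' j k) (tperm i i' * rcycle i' j k)%g.
  by apply: bruhat_tperm; rewrite // fi ri (ltn_trans ii).
apply: bruhat_trans B1 _.
have -> : rcycle i j k = (tperm i' k * (tperm i i' * rcycle i' j k))%g.
  rewrite /rcycle; apply/permP => z; rewrite !permM.
  by repeat case: tpermP; congruence.
move: (rcycle i' j k) fi rk => r fi rk.
apply: bruhat_tperm; rewrite ?(ltn_trans ij) // !permM tpermR fi tpermD ?rk //.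
all: by apply/eqP; congruence.
Qed.

(** Here the values at [i, i', j, k] change from [i, k, i', j] to [k, i, i', j] and then to
    [k, i', i, j]. *)
Lemma lcycle_bruhat i i' j k : i < i' -> i' < j -> j < k ->
  bruhat (lcycle i' j k) (lcycle i j k).
Proof.
move=> ii ij jk; have [li lj lk] := lcycleP ij jk.
have [nii nij ni] := ltn_neqs ii ij; have [_ njk nik] := ltn_neqs ij jk.
have [_ _ nk] := ltn_neqs ii (ltn_trans ij jk).
have fi : lcycle i' j k i = i.
  by rewrite lcycleE permM !tpermD //; apply/eqP; congruence.
have B1 : bruhat (lcycle i' j k) (tperm i i' * lcycle i' j k)%g.
  by apply: bruhat_tperm; rewrite // fi li (ltn_trans ii) // (ltn_trans ij).
apply: bruhat_trans B1 _.
have -> : lcycle i j k = (tperm i' j * (tperm i i' * lcycle i' j k))%g.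
  rewrite !lcycleE; apply/permP => z; rewrite !permM.
  by repeat case: tpermP; congruence.
move: (lcycle i' j k) fi lj => l fi lj.
apply: bruhat_tperm; rewrite // !permM tpermR fi tpermD ?lj //.
all: by apply/eqP; congruence.
Qed.

Lemma tperm_ltn_inj i j i' j' : i < j -> i' < j' -> tperm i j = tperm i' j' ->
  i = i' /\ j = j'.
Proof.
move=> ij ij' e; have /(congr1 (fun s : 'S_n => s i)) := e; rewrite tpermL.
case: tpermP => [-> <- //|ei je|_ _ je]; last by move: ij; rewrite je ltnn.
by move: ij ij'; rewrite ei je => /ltnW; rewrite leqNgt => /negbTE->.
Qed.

End Bruhat.

(** * From lists of edges to orders as sets of pairs *)

Section SetOrders.
Variable n : nat.
Notation edge := ('I_n * 'I_n)%type.
Implicit Types (i j k : 'I_n) (x y z : edge) (s t b l r : seq edge).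

Definition edge_perm x : 'S_n := tperm x.1 x.2.

Definition order_of_seq s : {set 'S_n * 'S_n} :=
  [set p | [exists x, exists y, [&& x \in s, y \in s, before s x y &
     p == (edge_perm x, edge_perm y)]]].

Lemma order_of_seqP s p :
  reflect (exists x y, [/\ x \in s, y \in s, before s x y &
             p = (edge_perm x, edge_perm y)]) (p \in order_of_seq s).
Proof.
rewrite inE; apply: (iffP existsP) =>
  [[x /existsP[y /and4P[xs ys xy /eqP->]]]|].
  by exists x, y.
by case=> x [y [xs ys xy ->]]; exists x; apply/existsP; exists y;
  rewrite xs ys xy /=.
Qed.

Definition increasing s := {in s, forall x, x.1 < x.2}.

Lemma edge_perm_inj s : increasing s -> {in s &, injective edge_perm}.
Proof.
move=> si [i j] [i' j'] /si/= ij /si/= ij' e.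
by have [-> ->] := tperm_ltn_inj ij ij' e.
Qed.

Lemma in_order_of_seq s x y : increasing s -> x \in s -> y \in s ->
  ((edge_perm x, edge_perm y) \in order_of_seq s) = before s x y.
Proof.
move=> /edge_perm_inj fI xs ys; apply/order_of_seqP/idP => [|xy];
  last by exists x, y.
by case=> x' [y' [xs' ys' xy []]] /(fI _ _ xs xs')-> /(fI _ _ ys ys')->.
Qed.

Lemma reverse_order_of_seq l b r :
  uniq (l ++ b ++ r) -> increasing (l ++ b ++ r) ->
  order_of_seq (l ++ rev b ++ r) =
  reverse_on [set g in map edge_perm b] (order_of_seq (l ++ b ++ r)).
Proof.
move=> us si; set s := l ++ b ++ r; set s' := l ++ rev b ++ r.
have ss' : s' =i s by move=> x; rewrite !mem_cat mem_rev.
have si' : increasing s' by move=> x; rewrite ss'; exact: si.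
have bs x : x \in b -> x \in s by rewrite !mem_cat => ->; rewrite orbT.
have bf x : x \in s -> (edge_perm x \in [set g in map edge_perm b]) = (x \in b).
  move=> xs; rewrite inE; apply/mapP/idP =>
    [[y yb /(edge_perm_inj si xs (bs _ yb))->//]|xb].
  by exists x.
have out s1 (p : 'S_n * 'S_n) : s1 =i s -> p \in order_of_seq s1 ->
    exists x y, [/\ x \in s, y \in s & p = (edge_perm x, edge_perm y)].
  by move=> e /order_of_seqP[x [y [xs ys _ ->]]]; exists x, y; rewrite -!e.
have both x y : x \in s -> y \in s ->
    ((edge_perm x, edge_perm y) \in order_of_seq s') =
    ((edge_perm x, edge_perm y) \in
       reverse_on [set g in map edge_perm b] (order_of_seq s)).
  move=> xs ys; rewrite [RHS]inE /= !bf // !in_order_of_seq ?ss' //.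
  by rewrite before_rev_cat.
apply/setP => p; apply/idP/idP => pin.
  by have [x [y [xs ys pE]]] := out _ _ ss' pin; rewrite pE -both // -pE.
have [x [y [xs ys pE]]] : exists x y,
    [/\ x \in s, y \in s & p = (edge_perm x, edge_perm y)].
  move: pin; rewrite inE; case: ifP => _; last exact: out.
  move/(out s) => [//|x [y [xs ys [e1 e2]]]]; exists y, x.
  by rewrite -e1 -e2 -surjective_pairing.
by rewrite pE both // -pE.
Qed.

Lemma consecutive_order_of_seq l x y r :
  uniq (l ++ x :: y :: r) -> increasing (l ++ x :: y :: r) ->
  consecutive (order_of_seq (l ++ x :: y :: r)) (edge_perm x) (edge_perm y).
Proof.
set s := l ++ _ => us si.
have xs : x \in s by rewrite mem_cat mem_head orbT.
have ys : y \in s by rewrite mem_cat !inE eqxx !orbT.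
have [xl yl xy] : [/\ x \notin l, y \notin l & x != y].
  move: us; rewrite cat_uniq => /and3P[_ /hasPn nl /=/andP[nx _]].
  split; [exact/nl/mem_head | by apply: nl; rewrite inE mem_head orbT |].
  by apply: contraNneq nx => ->; exact: mem_head.
have ix : index x s = size l by rewrite index_cat (negbTE xl) /= eqxx addn0.
have iy : index y s = (size l).+1.
  by rewrite index_cat (negbTE yl) /= (negbTE xy) eqxx addn1.
split; first by rewrite in_order_of_seq // /before ix iy.
move=> w [xw wy]; case/order_of_seqP: (xw) => x' [z [_ zs _ [_ wE]]].
move: xw wy; rewrite wE !in_order_of_seq // /before ix iy ltnS.
by move=> lz /(leq_trans lz); rewrite ltnn.
Qed.

(** * Edges and orientations of an admissible set *)

Section Admissible.
Variable A : {set 'S_n}.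
Hypothesis hA : admissible A.
Variable P : {set 'S_n * 'S_n}.
Hypothesis hP : compatible A P.

Definition edges i j : bool := (i < j) && (tperm i j \in A).

(** This instantiates the predicate [o] of the list argument: some path with top [k] over a nonedge
    has its right cycle in [A], and so asks for its lower edge first. *)
Definition orientation k : bool :=
  [exists i : 'I_n, exists j : 'I_n,
     [&& i < j, j < k, rcycle i j k \in A & tperm i k \notin A]].

Lemma edges_lt i j : edges i j -> i < j. Proof. by case/andP. Qed.

Lemma order_in (C : {set 'S_n * 'S_n}) (g h : 'S_n) :
  compatible A C -> (g, h) \in C -> g \in A /\ h \in A.
Proof.
case=> [[sub _ _ _] _ _ _] /(subsetP sub); rewrite !inE /=.
by case/andP=> /andP[-> _] /andP[-> _].
Qed.

(** The compatible order [P] compares [tperm i k] with the other two transpositions of the triangle,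
    which therefore lie in [A]. *)
Lemma edges_sub i j k : i < j -> j < k -> edges i k -> edges i j && edges j k.
Proof.
move=> ij jk /andP[_ ik]; rewrite /edges ij jk /=.
by case: (compatible_T hP ij jk ik) =>
  [] [] /(order_in hP)[] + + /(order_in hP)[];
   move=> -> _ _ ->.
Qed.

Lemma cycles23_rcycle i j k : i < j -> j < k -> rcycle i j k \in cycles23 n.
Proof.
move=> ij jk; rewrite !inE; apply/orP; right; apply/existsP; exists i.
by apply/existsP; exists j; apply/existsP; exists k; rewrite ij jk eqxx.
Qed.

Lemma cycles23_lcycle i j k : i < j -> j < k -> lcycle i j k \in cycles23 n.
Proof.
move=> ij jk; rewrite !inE; apply/orP; right; apply/existsP; exists i.
by apply/existsP; exists j; apply/existsP; exists k; rewrite ij jk eqxx orbT.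
Qed.

Lemma tperm_rcycle i j k :
  i < j -> j < k -> tperm i k \in A -> rcycle i j k \in A.
Proof.
move=> ij jk ik; apply: (admissible_down hA ik (cycles23_rcycle ij jk)).
exact: rcycle_bruhat_tperm.
Qed.

Lemma tperm_lcycle i j k :
  i < j -> j < k -> tperm i k \in A -> lcycle i j k \in A.
Proof.
move=> ij jk ik; apply: (admissible_down hA ik (cycles23_lcycle ij jk)).
exact: lcycle_bruhat_tperm.
Qed.

(** Over a nonedge, condition (b) with equal middle vertices excludes the left cycle, so [P] has to
    compare the two edges of the path. *)
Lemma rcycle_edges i j k : i < j -> j < k -> rcycle i j k \in A ->
  edges i j /\ edges j k.
Proof.
move=> ij jk ra; have [ik|ik] := boolP (tperm i k \in A).
  by apply/andP/edges_sub; rewrite // /edges ik (ltn_trans ij).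
have la : lcycle i j k \notin A.
  by apply: contra ik; apply: (admissible_RL hA) ra.
have [] := order_in hP (compatible_R hP ij jk ra la).
by rewrite /edges ij jk.
Qed.

Lemma lcycle_edges i j k : i < j -> j < k -> lcycle i j k \in A ->
  edges i j /\ edges j k.
Proof.
move=> ij jk la; have [ik|ik] := boolP (tperm i k \in A).
  by apply/andP/edges_sub; rewrite // /edges ik (ltn_trans ij).
have ra : rcycle i j k \notin A.
  by apply: contra ik => ra; apply: (admissible_RL hA) ra la.
have [] := order_in hP (compatible_L hP ij jk la ra).
by rewrite /edges ij jk.
Qed.

(* Enlarging the smaller of the two bottom vertices to the larger one keeps
   the cycles in [A] (they get smaller in the Bruhat order), so both cycles
   would lie in [A] over a common nonedge. *)
Lemma rcycle_lcycle_same_top i j i' j' k :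
  i < j -> j < k -> i' < j' -> j' < k ->
  rcycle i j k \in A -> lcycle i' j' k \in A ->
  (tperm i k \in A) || (tperm i' k \in A).
Proof.
move=> ij jk ij' jk' ra la.
have [ri rj] := rcycle_edges ij jk ra; have [li lj] := lcycle_edges ij' jk' la.
have edge_above (a d : 'I_n) : a <= d -> d < k -> edges a k -> tperm d k \in A.
  rewrite leq_eqVlt => /orP[/eqP/val_inj->|ad] dk; first by case/andP.
  by case/(edges_sub ad dk)/andP=> _ /andP[].
have [ii|ii|/val_inj ii] := ltngtP i i'.
- apply/orP; right; have ik' := ltn_trans ij' jk'.
  (* If [j <= i'], the cycle cannot be shrunk to start at [i'], but the edge [(j,k)] already forces
     [(i',k)]. *)
  have [ji|ij1] := leqP j i'; first exact: edge_above ji ik' rj.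
  apply: (admissible_RL hA ij1 jk ij' jk') la.
  exact: (admissible_down hA ra (cycles23_rcycle ij1 jk)
    (rcycle_bruhat ii ij1 jk)).
- apply/orP; left; have ik := ltn_trans ij jk.
  have [ji|ij1] := leqP j' i; first exact: edge_above ji ik lj.
  apply: (admissible_RL hA ij jk ij1 jk') => //.
  exact: (admissible_down hA la (cycles23_lcycle ij1 jk')
    (lcycle_bruhat ii ij1 jk')).
- by subst i'; apply/orP; left; apply: (admissible_RL hA ij jk ij' jk').
Qed.

(** Condition (c) puts one of the two cycles in [A]. A witness of [orientation k] excludes the left
    one by [rcycle_lcycle_same_top]; otherwise the right one would itself be a witness. *)
Lemma orientation_rcycle i j k : edges i j -> edges j k -> ~~ edges i k ->
  (rcycle i j k \in A) = orientation k /\ (lcycle i j k \in A) =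
    ~~ orientation k.
Proof.
move=> /andP[ij ijA] /andP[jk jkA]; rewrite {1}/edges (ltn_trans ij jk) /= =>
  ikA.
have [/existsP[i' /existsP[j' /and4P[ij' jk' ra' ikA']]]|no] :=
  boolP (orientation k).
  have la : lcycle i j k \notin A.
    apply: contra ikA => la; have :=
      rcycle_lcycle_same_top ij' jk' ij jk ra' la.
    by rewrite (negbTE ikA').
  by case: (admissible_TT hA ij jk ijA jkA) => ca;
    [rewrite ca (negbTE la) | rewrite ca in la].
have ra : rcycle i j k \notin A.
  apply: contra no => ra; apply/existsP; exists i; apply/existsP; exists j.
  by rewrite ij jk ra.
by case: (admissible_TT hA ij jk ijA jkA) => ca;
  [rewrite ca in ra | rewrite ca (negbTE ra)].
Qed.

(** * Correspondence between valid lists and compatible orders *)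

Notation valid_seq := (valid edges orientation n).

Lemma valid_seq_mem s x : valid_seq s -> (x \in s) = edges x.1 x.2.
Proof. by move/valid_mem->; rewrite ltn_ord andbT. Qed.

Lemma valid_seq_increasing s : valid_seq s -> increasing s.
Proof. by move=> vs x; rewrite (valid_seq_mem _ vs) => /edges_lt. Qed.

Lemma mem_edge_perm (g : 'S_n) :
  reflect (exists2 x, edges x.1 x.2 & g = edge_perm x)
    (g \in A :&: transpositions n).
Proof.
apply: (iffP idP) => [|[[i j] /= /andP[ij ijA] ->]].
  rewrite !inE => /andP[gA /existsP[i /existsP[j /andP[ij /eqP gE]]]].
  by exists (i, j); rewrite // /edges ij -gE.
rewrite !inE ijA; apply/existsP; exists i; apply/existsP; exists j.
by rewrite ij eqxx.
Qed.

Lemma compatible_order_of_seq s : valid_seq s -> compatible A (order_of_seq s).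
Proof.
move=> vs; have si := valid_seq_increasing vs; have sm x := valid_seq_mem x vs.
have inj := edge_perm_inj si.
split=> [|i j k ij jk ra la|i j k ij jk la ra|i j k ij jk ikA].
- split=> [|g|g h w|g h].
  + apply/subsetP => p /order_of_seqP[x [y [xs ys _ ->]]]; rewrite in_setX /=.
    by apply/andP; split; apply/mem_edge_perm; [exists x | exists y];
      rewrite // -sm.
  + apply/order_of_seqP => -[x [y [xs ys + [gx gy]]]].
    have -> : x = y by apply: inj; rewrite // -gx.
    by rewrite /before ltnn.
  + move=> /order_of_seqP[x [y [xs ys xy [-> ->]]]].
    move=> /order_of_seqP[y' [z [ys' zs yz [/(inj _ _ ys ys') yy ->]]]].
    rewrite in_order_of_seq //; apply: before_trans xy _; by rewrite yy.
  + move=> /mem_edge_perm[x] + -> /mem_edge_perm[y] + ->; rewrite -!sm =>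
    xs ys xy.
    rewrite !in_order_of_seq // /before; apply/orP; rewrite -neq_ltn.
    by apply: contra_neq xy => e; rewrite -(nth_index x xs) e nth_index.
- have [eij ejk] := rcycle_edges ij jk ra.
  (* By downward closure [tperm i k] would bring the left cycle into [A], so the prescription is
     that of a path over a nonedge. *)
  have eik : ~~ edges i k.
    by rewrite /edges negb_and (contra (tperm_lcycle ij jk) la) orbT.
  have [ok _] := orientation_rcycle eij ejk eik; rewrite ra in ok.
  rewrite (in_order_of_seq (x := (i, j)) (y := (j, k))) ?sm //.
  by have := valid_path vs (ltn_ord k) eij ejk eik; rewrite -ok.
- have [eij ejk] := lcycle_edges ij jk la.
  have eik : ~~ edges i k.
    by rewrite /edges negb_and (contra (tperm_rcycle ij jk) ra) orbT.
  have [ok _] := orientation_rcycle eij ejk eik; rewrite (negbTE ra) in ok.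
  rewrite (in_order_of_seq (x := (j, k)) (y := (i, j))) ?sm //.
  by have := valid_path vs (ltn_ord k) eij ejk eik; rewrite -ok.
- have eik : edges i k by rewrite /edges (ltn_trans ij jk).
  have /andP[eij ejk] := edges_sub ij jk eik.
  rewrite -![tperm i j]/(edge_perm (i, j)) -![tperm i k]/(edge_perm (i, k)).
  rewrite -![tperm j k]/(edge_perm (j, k)) !in_order_of_seq ?sm //.
  have := valid_triangle vs ij jk (ltn_ord k) eik.
  by case/orP=> /andP[-> ->]; [left | right].
Qed.

Lemma order_of_seq_surj (C : {set 'S_n * 'S_n}) : compatible A C ->
  exists2 s, valid_seq s & order_of_seq s = C.
Proof.
move=> hC; have [[sub irr tr tot] cR cL cT] := hC.
(* The list is found by sorting the edges by their number of predecessors in [C], which increases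
   strictly along [C]. *)
pose rank (g : 'S_n) := #|[set h | (h, g) \in C]|.
have rank_lt g h : (g, h) \in C -> rank g < rank h.
  move=> gh; apply/proper_card/properP; split.
    by apply/subsetP => w; rewrite !inE => /tr; apply.
  by exists g; rewrite !inE.
pose leT x y := rank (edge_perm x) <= rank (edge_perm y).
pose s := sort leT (enum [pred x : edge | edges x.1 x.2]).
have sm x : (x \in s) = edges x.1 x.2 by rewrite mem_sort mem_enum.
have su : uniq s by rewrite sort_uniq enum_uniq.
have si : increasing s by move=> x; rewrite sm => /edges_lt.
have ss : sorted leT s by apply: sort_sorted => x y; exact: leq_total.
have bE x y : x \in s -> y \in s -> before s x y =
  ((edge_perm x, edge_perm y) \in C).
  move=> xs ys; have fA z : z \in s -> edge_perm z \in A :&: transpositions n.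
    by rewrite sm => zE; apply/mem_edge_perm; exists z.
  have le z w : z \in s -> w \in s -> index z s <= index w s ->
      rank (edge_perm z) <= rank (edge_perm w).
    apply: (sorted_leq_index _ _ ss) => [? ? ?|?];
      [exact: leq_trans|exact: leqnn].
  apply/idP/idP => [xy|/rank_lt]; last first.
    by rewrite ltnNge => xy; rewrite /before ltnNge; apply: contra xy => /le;
      apply.
  have nxy : edge_perm x != edge_perm y.
    apply/eqP => /(edge_perm_inj si xs ys) exy.
    by move: xy; rewrite exy /before ltnn.
  case: (tot _ _ (fA _ xs) (fA _ ys) nxy) => // /rank_lt.
  by rewrite ltnNge le // ltnW.
exists s.
  split=> // [x|i j k ij jk _ ik|i j k _ eij ejk eik].
  - by rewrite sm ltn_ord andbT.
  - have /andP[eij ejk] := edges_sub ij jk ik; rewrite !bE ?sm //.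
    have /andP[_ ikA] := ik.
    by case: (cT _ _ _ ij jk ikA) => -[-> ->]; rewrite // orbT.
  - have [rE lE] := orientation_rcycle eij ejk eik.
    have [ij jk] := (edges_lt eij, edges_lt ejk).
    case: (boolP (orientation k)) rE lE => _ rE lE; rewrite bE ?sm //.
      by apply: cR; rewrite // ?rE ?lE.
    by apply: cL; rewrite // ?rE ?lE.
apply/setP => p; apply/order_of_seqP/idP => [[x [y [xs ys]]]|].
  by rewrite bE // => xy ->.
case: p => g h gh; have := subsetP sub _ gh; rewrite in_setX /=.
case/andP=> /mem_edge_perm[x xE gx] /mem_edge_perm[y yE hy].
by exists x, y; rewrite bE !sm // -gx -hy.
Qed.

Lemma move_elementary s t : valid_seq s -> move s t ->
  elementary A (order_of_seq s) (order_of_seq t).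
Proof.
move=> vs mst; have cs := compatible_order_of_seq vs.
have si := valid_seq_increasing vs; have us := valid_uniq vs.
case: mst vs cs si us => l b r bb vs cs si us.
rewrite reverse_order_of_seq //.
case: bb vs cs si us => [x y xx yy xy|i j k ij jk|i j k ij jk] vs cs si us.
- have -> : [set g in map edge_perm [:: x; y]] =
      [set tperm x.1 x.2; tperm y.1 y.2] by apply/setP => g; rewrite !inE.
  apply: elementary_swap => //; last exact: consecutive_order_of_seq.
  move: xy; rewrite /commuting disjoint_subset => /and4P[n1 n2 n3 n4].
  apply/subsetP => z; rewrite !inE => /orP[] /eqP->; rewrite negb_or.
    by rewrite n1.
  by rewrite n3.
- have -> : [set g in map edge_perm [:: (i, j); (i, k); (j, k)]] =
      [set tperm i j; tperm i k; tperm j k].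
    by apply/setP => g; rewrite !inE orbA.
  apply: elementary_reverse => //; left; split.
    exact: (consecutive_order_of_seq us si).
  have := @consecutive_order_of_seq (rcons l (i, j)) (i, k) (j, k) r.
  by rewrite cat_rcons; apply.
- have -> : [set g in map edge_perm [:: (j, k); (i, k); (i, j)]] =
      [set tperm i j; tperm i k; tperm j k].
    by apply/setP => g; rewrite !inE [RHS]orbC [X in _ || X]orbC.
  apply: elementary_reverse => //; right; split.
    exact: (consecutive_order_of_seq us si).
  have := @consecutive_order_of_seq (rcons l (j, k)) (i, k) (i, j) r.
  by rewrite cat_rcons; apply.
Qed.

Lemma moves_equivalent s t : valid_seq s -> moves s t ->
  equivalent_orders A (order_of_seq s) (order_of_seq t).
Proof.
move=> vs mst; elim: mst vs =>
  [a d /move_elementary ad va|a _|a d e ad IH1 de IH2 va].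
- by apply: rt_step; exact: ad.
- exact: rt_refl.
- apply: rt_trans (IH1 va) (IH2 _).
  exact: (moves_valid edges_lt ad va).
Qed.

End Admissible.
End SetOrders.

Theorem lemma4p9 (n : nat) (hn : 0 < n) (A : {set 'S_n}) (hA : admissible A)
    (P Q : {set 'S_n * 'S_n}) (hP : compatible A P) (hQ : compatible A Q) :
  equivalent_orders A P Q.
Proof.
have [s vs <-] := order_of_seq_surj hA hP hP.
have [t vt <-] := order_of_seq_surj hA hP hQ.
apply: (moves_equivalent hA hP) => //.
exact: (valid_moves (@edges_lt n A) (edges_sub hP) (leqnn n) vs vt).
Qed.
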